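(* Let $\mathcal{C}$ be the split Cayley algebra over a field $\mathbb{F}$. Then any $2$-local derivation of $\mathcal{C}$ is a derivation.
   Context: A Cayley algebra over a field $\mathbb{F}$ is a unital (not necessarily associative) $\mathbb{F}$-algebra $\mathcal{C}$ of dimension $8$ endowed with a quadratic form $\mathrm{n}:\mathcal{C}\to\mathbb{F}$ (the norm) that is multiplicative, $\mathrm{n}(xy)=\mathrm{n}(x)\mathrm{n}(y)$ for all $x,y\in\mathcal{C}$, and nonsingular, i.e. its polar form $\mathrm{n}(x,y):=\mathrm{n}(x+y)-\mathrm{n}(x)-\mathrm{n}(y)$ is a nondegenerate bilinear form. The norm is isotropic if $\mathrm{n}(x)=0$ for some nonzero $x\in\mathcal{C}$. Up to isomorphism there is a unique Cayley algebra over $\mathbb{F}$ with isotropic norm; it is called the split Cayley algebra. It has a canonical basis $\{e_1,e_2,u_1,u_2,u_3,v_1,v_2,v_3\}$ with multiplication: $e_1^2=e_1$, $e_2^2=e_2$, $e_1e_2=e_2e_1=0$; $e_1u_i=u_i=u_ie_2$, $e_2u_i=0=u_ie_1$; $e_2v_i=v_i=v_ie_1$, $e_1v_i=0=v_ie_2$; $u_i^2=0=v_i^2$; $u_1u_2=v_3=-u_2u_1$, $u_2u_3=v_1=-u_3u_2$, $u_3u_1=v_2=-u_1u_3$; $v_1v_2=u_3=-v_2v_1$, $v_2v_3=u_1=-v_3v_2$, $v_3v_1=u_2=-v_1v_3$; $u_iv_j=-\delta_{ij}e_1$, $v_iu_j=-\delta_{ij}e_2$. A derivation of $\mathcal{C}$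 is a linear map $d:\mathcal{C}\to\mathcal{C}$ with $d(xy)=d(x)y+xd(y)$ for all $x,y$. A $2$-local derivation of $\mathcal{C}$ is a map $\Delta:\mathcal{C}\to\mathcal{C}$ (not assumed linear) such that for every pair $x,y\in\mathcal{C}$ there is a derivation $d_{x,y}$ of $\mathcal{C}$ (depending on $x,y$) with $\Delta(x)=d_{x,y}(x)$ and $\Delta(y)=d_{x,y}(y)$. *)

(* Defs.v *)
From HB Require Import structures.
From mathcomp Require Import all_boot all_algebra.

Set Implicit Arguments.
Unset Strict Implicit.
Unset Printing Implicit Defensive.

Import GRing.Theory.
Local Open Scope ring_scope.

(* MathComp rings are associative, so a nonassociative algebra is given here   *)
(* by a vector space C together with a bilinear product mul on it.             *)

Section QuadraticForms.
Variables (F : fieldType) (V : vectType F).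
Implicit Type n : V -> F.

Definition polar n (x y : V) : F := n (x + y) - n x - n y.

Definition quadratic_form n : Prop :=
  (forall (a : F) (x : V), n (a *: x) = a ^+ 2 * n x) /\
  bilinear_for *%R *%R (polar n).

(* Nondegeneracy of the polar form, also in characteristic 2.  The predicate   *)
(* nondegenerate of sesquilinear.v only applies to bundled hermitian forms.    *)
Definition nonsingular n : Prop :=
  forall x : V, (forall y : V, polar n x y = 0) -> x = 0.

Definition isotropic n : Prop := exists2 x : V, x != 0 & n x = 0.

End QuadraticForms.

Section CayleyAlgebras.
Variables (F : fieldType) (C : vectType F).
Implicit Types (mul : {bilinear C -> C -> C}) (one : C) (n : C -> F).

Record cayley_algebra mul one n : Prop := CayleyAlgebra {
  cayley_dim : \dim {:C} = 8%N;
  cayley_mul1r : left_id one mul;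
  cayley_mulr1 : right_id one mul;
  cayley_quadratic : quadratic_form n;
  cayley_normM : {morph n : x y / mul x y >-> x * y};
  cayley_nonsingular : nonsingular n
}.

Definition split_cayley_algebra mul one n : Prop :=
  cayley_algebra mul one n /\ isotropic n.

Definition derivation mul (d : C -> C) : Prop :=
  linear d /\ forall x y : C, d (mul x y) = mul (d x) y + mul x (d y).

Definition two_local_derivation mul (Delta : C -> C) : Prop :=
  forall x y : C, exists d : C -> C,
    [/\ derivation mul d, Delta x = d x & Delta y = d y].

End CayleyAlgebras.

(* Main.v *)
Require Import Defs.
From HB Require Import structures.
From mathcomp Require Import all_boot all_algebra.
From mathcomp Require Import ring.

(** Write n(x,y) for the polar form of the norm, 1 for the unit, and
    x^* = n(x,1) 1 - x for the conjugate of x.  Let Delta be a 2-local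
    derivation.

    Linearity.  Every derivation d is skew for the polar form
    ([polar_derivation]), so evaluating on pairs gives
    n(Delta x, y) = - n(x, Delta y) for all x and y.  The right-hand side is
    linear in x and the polar form is nondegenerate, hence Delta is linear
    ([two_local_linear]).

    Leibniz rule.  Let D(x,y) = Delta(xy) - Delta(x)y - x Delta(y), which is
    now bilinear.  If the derivation d agrees with Delta at x and at xy, then
    D(x,y) = x (d(y) - Delta(y)), so D(x,y) lies in the right multiple space xC
    ([leibniz_defect_right_multiple]), while D(1,y) = 0.  Let e have norm 0 and
    trace n(e,1) = 1; then e^* = 1 - e, and D(e,y) = - D(e^*,y) lies both in eC
    and in e^*C.  Since x^*(xz) = n(x)z ([mul_conjK]), these two spaces meet
    only in 0, and D(e,y) = 0.

    It remains to see that such e span C ([trace1_null_span]).  An isotropic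
    norm provides one of them, say e ([trace1_null_exists]).  A vector w of norm 0
    orthogonal to 1 and e is the difference of e + w and e, both of norm 0 and
    trace 1; and a vector x orthogonal to 1 and e is the sum ex + e^*x of two
    vectors of norm 0 orthogonal to 1 and e.  Together with e and e^* the vectors
    orthogonal to 1 and e span C.  The argument uses no restriction on the
    characteristic. *)

Set Implicit Arguments.
Unset Strict Implicit.
Unset Printing Implicit Defensive.

Import GRing.Theory.
Local Open Scope ring_scope.

(** * Quadratic forms *)

Section QuadraticForm.
Variables (F : fieldType) (V : vectType F) (n : V -> F).
Hypothesis quad : quadratic_form n.
Local Notation b := (polar n).

Lemma normZ a x : n (a *: x) = a ^+ 2 * n x.
Proof. exact: quad.1. Qed.

Lemma normD x y : n (x + y) = n x + n y + b x y.
Proof. by rewrite /polar; ring. Qed.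

Lemma polarC x y : b x y = b y x.
Proof. by rewrite /polar [y + x]addrC; ring. Qed.

Lemma polarPl a x y z : b (a *: x + y) z = a * b x z + b y z.
Proof. exact: (quad.2.1 z). Qed.

Lemma polarPr a x y z : b z (a *: x + y) = a * b z x + b z y.
Proof. exact: (quad.2.2 z). Qed.

Lemma polarDl x y z : b (x + y) z = b x z + b y z.
Proof. by rewrite -[x]scale1r polarPl scale1r mul1r. Qed.

Lemma polar0l z : b 0 z = 0.
Proof. by apply: (addIr (b 0 z)); rewrite -polarDl addr0 add0r. Qed.

Lemma polarZl a x z : b (a *: x) z = a * b x z.
Proof. by rewrite -[a *: x]addr0 polarPl polar0l addr0. Qed.

Lemma polarNl x z : b (- x) z = - b x z.
Proof. by rewrite -scaleN1r polarZl mulN1r. Qed.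

Lemma polarBl x y z : b (x - y) z = b x z - b y z.
Proof. by rewrite polarDl polarNl. Qed.

Lemma polarDr x y z : b z (x + y) = b z x + b z y.
Proof. by rewrite polarC polarDl !(polarC z). Qed.

Lemma polarZr a x z : b z (a *: x) = a * b z x.
Proof. by rewrite polarC polarZl (polarC z). Qed.

Lemma polarNr x z : b z (- x) = - b z x.
Proof. by rewrite polarC polarNl (polarC z). Qed.

Lemma polarBr x y z : b z (x - y) = b z x - b z y.
Proof. by rewrite polarDr polarNr. Qed.

Lemma norm0 : n 0 = 0.
Proof. by rewrite -[0](scale0r 0) normZ expr0n mul0r. Qed.

Lemma normN x : n (- x) = n x.
Proof. by rewrite -scaleN1r normZ sqrrN expr1n mul1r. Qed.

Lemma polarxx x : b x x = n x *+ 2.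
Proof. by rewrite /polar -mulr2n -scaler_nat normZ; ring. Qed.

Lemma polar_inj : nonsingular n ->
  forall x y, (forall z, b x z = b y z) -> x = y.
Proof.
move=> nons x y eq_xy; apply/eqP; rewrite -subr_eq0; apply/eqP/nons=> z.
by rewrite polarBl eq_xy subrr.
Qed.

(** The vector y is found constructively, by scanning a basis of V. *)
Lemma polar_neq0 : nonsingular n ->
  forall x, x != 0 -> exists y, b x y = 1.
Proof.
move=> nons x nz_x; set v := vbasis {:V}.
have [/existsP[i nz_bi] | ] := boolP [exists i, b x (tnth v i) != 0].
  by exists ((b x (tnth v i))^-1 *: tnth v i); rewrite polarZr mulVf.
rewrite negb_exists => /forallP b0; case/negP: nz_x; apply/eqP/nons=> y.
rewrite (coord_vbasis (memvf y)).
elim/big_rec: _ => [|i z _ IH]; first by rewrite polarC // polar0l.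
have := b0 i; rewrite negbK => /eqP b0i.
by rewrite polarPr IH -tnth_nth b0i mulr0 addr0.
Qed.

End QuadraticForm.

(** * Composition algebras *)

Section Composition.
Variables (F : fieldType) (C : vectType F).
Variables (mul : {bilinear C -> C -> C}) (one : C) (n : C -> F).
Hypothesis mul1x : left_id one mul.
Hypothesis mulx1 : right_id one mul.
Hypothesis quad : quadratic_form n.
Hypothesis normM : {morph n : x y / mul x y >-> x * y}.
Hypothesis nons : nonsingular n.
Hypothesis iso : isotropic n.
Local Notation b := (polar n).
Local Notation "x ** y" := (mul x y) (at level 40, left associativity).

Let polE := (polarDl quad, polarBl quad, polarNl quad, polarZl quad,
             polarDr quad, polarBr quad, polarNr quad, polarZr quad).

(** The conjugate of an element of the algebra. *)
Definition conj x := b x one *: one - x.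

Lemma norm_one : n one = 1.
Proof.
have [a nz_a _] := iso; have [y b1] := polar_neq0 quad nons nz_a.
have [n0|nz_n] := eqVneq (n one) 0.
  have nE z : n z = 0 by rewrite -(mul1x z) normM n0 mul0r.
  by move/eqP: b1; rewrite /polar !nE !subr0 eq_sym oner_eq0.
by apply: (mulfI nz_n); rewrite -normM mul1x mulr1.
Qed.

Lemma polar_mul x y z : b (x ** y) (x ** z) = n x * b y z.
Proof. by rewrite /polar -linearDr !normM; ring. Qed.

Lemma polar_mul_cross x y z w :
  b (x ** y) (w ** z) + b (w ** y) (x ** z) = b x w * b y z.
Proof.
have := polar_mul (x + w) y z.
rewrite !linearDl !polE !polar_mul (normD n) => E.
have -> : b x w * b y z = (n x + n w + b x w) * b y z - n x * b y z - n w * b y z.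
  by ring.
by rewrite -E; ring.
Qed.

Lemma polar_adjoint x y z : b (x ** y) z = b y (conj x ** z).
Proof.
have := polar_mul_cross x y z one; rewrite !mul1x => E.
rewrite /conj linearBl linearZl_LR mul1x !polE -E; ring.
Qed.

Lemma mul_conjK x a : conj x ** (x ** a) = n x *: a.
Proof.
apply: (polar_inj quad nons) => z.
by rewrite polarC // -polar_adjoint polarC // polar_mul polarZl // polarC.
Qed.

Lemma mul_sqr x : x ** x = b x one *: x - n x *: one.
Proof.
have := mul_conjK x one; rewrite mulx1 /conj linearBl linearZl_LR mul1x /= => <-.
by rewrite subKr.
Qed.

Lemma mul_anticomm x y :
  x ** y + y ** x = b x one *: y + b y one *: x - b x y *: one.
Proof.
apply: (polar_inj quad nons) => z; rewrite polarDl //.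
have -> : b (x ** y) z + b (y ** x) z =
    b ((x + y) ** (x + y)) z - b (x ** x) z - b (y ** y) z.
  by rewrite linearDl !linearDr /= !polE; ring.
by rewrite !mul_sqr (normD n) !polE; ring.
Qed.

(** * Derivations and 2-local derivations *)

Lemma derivation_one d : derivation mul d -> d one = 0.
Proof.
move=> [_ dM]; have := dM one one; rewrite !mulx1 mul1x => /eqP.
by rewrite -subr_eq0 opprD addrA subrr add0r oppr_eq0 => /eqP.
Qed.

Lemma derivationD d x y : derivation mul d -> d (x + y) = d x + d y.
Proof. by case=> dL _; rewrite -[x]scale1r dL !scale1r. Qed.

Lemma derivationZ d a x : derivation mul d -> d (a *: x) = a *: d x.
Proof.
move=> dd; have d0 : d 0 = 0.
  by apply: (addIr (d 0)); rewrite -derivationD // addr0 add0r.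
by case: (dd) => dL _; rewrite -[a *: x]addr0 dL d0 addr0.
Qed.

(** Applying a derivation d to the quadratic equation satisfied by x gives
    n(d x, 1) x = n(x, d x) 1; both coefficients vanish unless x is a scalar,
    in which case d x = 0. *)
Lemma polar_derivation_self d x : derivation mul d -> b x (d x) = 0.
Proof.
move=> dd; have d1 := derivation_one dd.
have dB u v : d (u - v) = d u - d v.
  by rewrite derivationD // -scaleN1r derivationZ // scaleN1r.
have E : b (d x) one *: x = b x (d x) *: one.
  have := congr1 d (mul_sqr x); rewrite dd.2 dB !(derivationZ _ _ dd) d1 scaler0 subr0.
  rewrite addrC mul_anticomm => /eqP.
  by rewrite -addrA -subr_eq0 addrAC subrr add0r subr_eq0 => /eqP.
have [t0|nz_t] := eqVneq (b (d x) one) 0.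
  have := congr1 n E; rewrite t0 scale0r norm0 // normZ // norm_one mulr1 => /esym/eqP.
  by rewrite sqrf_eq0 => /eqP.
have xE : x = ((b (d x) one)^-1 * b x (d x)) *: one.
  by rewrite -scalerA -E scalerA mulVf // scale1r.
have dx0 : d x = 0 by rewrite xE derivationZ // d1 scaler0.
by rewrite dx0 polar0l ?eqxx in nz_t.
Qed.

(** Derivations are skew for the polar form of the norm. *)
Lemma polar_derivation d x y : derivation mul d -> b (d x) y = - b x (d y).
Proof.
move=> dd; have := polar_derivation_self (x + y) dd.
rewrite derivationD // !polE (polar_derivation_self x dd) (polar_derivation_self y dd) add0r addr0 => /eqP.
by rewrite addrC addr_eq0 polarC // => /eqP ->; rewrite polarC // opprK.
Qed.

Section TwoLocal.
Variable Delta : C -> C.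
Hypothesis loc : two_local_derivation mul Delta.

Lemma polar_two_local x y : b (Delta x) y = - b x (Delta y).
Proof. by have [d [dd -> ->]] := loc x y; apply: polar_derivation. Qed.

Lemma two_local_linear : linear Delta.
Proof.
move=> a x y; apply: (polar_inj quad nons) => z.
by rewrite !polE !polar_two_local !polE; ring.
Qed.

(** The failure of the Leibniz rule for Delta. *)
Definition leibniz_defect x y :=
  Delta (x ** y) - Delta x ** y - x ** Delta y.

Lemma leibniz_defect_right_multiple x y :
  exists z, leibniz_defect x y = x ** z.
Proof.
have [d [dd Dx Dxy]] := loc x (x ** y); exists (d y - Delta y).
by rewrite /leibniz_defect Dx Dxy dd.2 linearBr [d x ** y + _]addrC addrK.
Qed.

Lemma leibniz_defectPl a x x' y :
  leibniz_defect (a *: x + x') y = a *: leibniz_defect x y + leibniz_defect x' y.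
Proof.
apply: (polar_inj quad nons) => z.
by rewrite /leibniz_defect linearPl !two_local_linear !linearPl !polE; ring.
Qed.

Lemma leibniz_defect1 y : leibniz_defect one y = 0.
Proof.
have [d [dd D1 _]] := loc one one.
by rewrite /leibniz_defect D1 derivation_one // linear0l !mul1x subr0 subrr.
Qed.

Lemma leibniz_defect_trace1_null e y :
  n e = 0 -> b e one = 1 -> leibniz_defect e y = 0.
Proof.
move=> ne te.
have cE : conj e = one - e by rewrite /conj te scale1r.
have ccE : conj (conj e) = e.
  by rewrite {1}/conj cE !polE te (polarxx quad) norm_one mulr2n addrK scale1r subKr.
have ncE : n (conj e) = 0.
  rewrite cE (normD n) normN // norm_one ne !polE polarC // te; ring.
have [z zE] := leibniz_defect_right_multiple e y.
have [w wE] := leibniz_defect_right_multiple (conj e) y.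
have Dsum : leibniz_defect e y = - leibniz_defect (conj e) y.
  have -> : conj e = -1 *: e + one by rewrite cE scaleN1r addrC.
  by rewrite leibniz_defectPl leibniz_defect1 addr0 scaleN1r opprK.
(* The common value is annihilated by e^* and by e, hence by 1 = e + e^*. *)
have A1 : conj e ** leibniz_defect e y = 0 by rewrite zE mul_conjK ne scale0r.
have A2 : e ** leibniz_defect e y = 0.
  by rewrite Dsum wE linearNr -{1}ccE /= mul_conjK ncE scale0r oppr0.
by rewrite -[LHS]mul1x -[one](subrK e) -cE linearDl /= A1 A2 addr0.
Qed.

End TwoLocal.

(** * Elements of norm 0 and trace 1 *)

Lemma trace1_null_exists : exists2 e, n e = 0 & b e one = 1.
Proof.
have [a nz_a na] := iso.
have nz_ca : conj a != 0.
  apply: contraNneq nz_a => /eqP; rewrite subr_eq0 => /eqP aE.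
  have /eqP : b a one ^+ 2 = 0.
    by rewrite -na -[in RHS]aE normZ // norm_one mulr1.
  by rewrite sqrf_eq0 => /eqP t0; rewrite -aE t0 scale0r.
have [z bz] := polar_neq0 quad nons nz_ca.
exists (a ** z); first by rewrite normM na mul0r.
by rewrite polar_adjoint mulx1 polarC.
Qed.

(** A subspace, given as a predicate, containing every element of norm 0 and
    trace 1 is the whole algebra. *)
Lemma trace1_null_span (P : C -> Prop) :
    (forall a x y, P x -> P y -> P (a *: x + y)) ->
    (forall e, n e = 0 -> b e one = 1 -> P e) ->
  forall x, P x.
Proof.
move=> Plin Pe x; have [e ne te] := trace1_null_exists.
have cE : conj e = one - e by rewrite /conj te scale1r.
have nce : n (conj e) = 0.
  rewrite cE (normD n) normN // norm_one ne !polE polarC // te; ring.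
have tce : b (conj e) one = 1.
  rewrite cE !polE te (polarxx quad) norm_one; ring.
have Pnull w : n w = 0 -> b w one = 0 -> b w e = 0 -> P w.
  move=> nw tw bw; rewrite -[w](addKr e) -scaleN1r; apply: Plin (Pe _ ne te) _.
  apply: Pe; first by rewrite (normD n) ne nw polarC // bw !addr0.
  by rewrite !polE te tw addr0.
have Porth w : b w one = 0 -> b w e = 0 -> P w.
  move=> tw bw.
  have wE : w = 1 *: (e ** w) + conj e ** w.
    by rewrite scale1r -linearDl cE addrC subrK mul1x.
  have bmul u v : n u = 0 -> b (u ** v) u = 0.
    by move=> nu; rewrite -{2}[u]mulx1 polar_mul nu mul0r.
  have t_ew : b (e ** w) one = 0 by rewrite polar_adjoint mulx1 cE !polE tw bw subr0.
  rewrite wE; apply: Plin; apply: Pnull => //.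
  - by rewrite normM ne mul0r.
  - exact: bmul.
  - by rewrite normM nce mul0r.
  - by rewrite cE linearBl mul1x polarBl // tw t_ew subr0.
  - by rewrite cE linearBl mul1x polarBl // bw bmul // subr0.
(* The hyperbolic plane spanned by e and e^* splits off. *)
have -> : x = b x (conj e) *: e + (b x e *: conj e +
    (x - b x (conj e) *: e - b x e *: conj e)).
  by rewrite [X in _ = _ + X]addrC subrK addrC subrK.
apply: (Plin _ _ _ (Pe _ ne te)); apply: (Plin _ _ _ (Pe _ nce tce)); apply: Porth.
- by rewrite cE !polE (polarxx quad) norm_one te; ring.
- by rewrite cE !polE (polarxx quad) ne (polarC n one e) te; ring.
Qed.
End Composition.

Theorem theorem4p1 (F : fieldType) (C : vectType F)
    (mul : {bilinear C -> C -> C}%R) (one : C) (n : C -> F)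
    (splitC : split_cayley_algebra mul one n)
    (Delta : C -> C) :
  two_local_derivation mul Delta -> derivation mul Delta.
Proof.
move=> loc; case: splitC => -[_ mul1x mulx1 quad normM nons] iso.
split; first exact: (two_local_linear mul1x mulx1 quad normM nons iso).
move=> x y; apply/eqP; rewrite -subr_eq0 opprD addrA; apply/eqP.
rewrite -/(leibniz_defect mul Delta x y); move: x.
apply: (trace1_null_span mul1x mulx1 quad normM nons iso).
  move=> a x x' Dx Dx'; rewrite (leibniz_defectPl mul1x mulx1 quad normM nons iso loc).
  by rewrite Dx Dx' scaler0 addr0.
move=> e ne te.
exact: (leibniz_defect_trace1_null mul1x mulx1 quad normM nons iso loc).
Qed.
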